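(* Let $B^2=\{z\in\mathbb C^2:\|z\|<1\}$, and set $B(z,w)=1-\langle z,w\rangle$ and $D(z)=B(z,z)$. For $z,w\in B^2$, one has $B(z,w)\neq0$ and $D(z)\neq0$. Consequently the functions $$M(z,w)=|B(z,w)|,\qquad L(z)=D(z),\qquad R_L(z,w)=\frac{M(z,w)}{L(z)},\qquad U(z,w)=\frac{B(z,w)}{M(z,w)}$$ are defined, and $$\frac{B(z,w)^{-\gamma}}{D(z)^{-\gamma}}=U(z,w)^{-\gamma}\,R_L(z,w)^{-\gamma}.$$
   Context: Here $\langle z,w\rangle$ is the positive definite Euclidean Hermitian pairing on $\mathbb C^2$, $\langle z,w\rangle=z_1\overline{w_1}+z_2\overline{w_2}$, with norm $\|z\|^2=\langle z,z\rangle$, and $\gamma$ is a nonzero exponent. *)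

(* Defs.v *)
From mathcomp Require Import all_boot all_order all_algebra.
From mathcomp Require Import spectral.
From mathcomp Require Import complex.
From mathcomp Require Import boolp classical_sets reals sequences exp trigo.

Set Implicit Arguments.
Unset Strict Implicit.
Unset Printing Implicit Defensive.

Import Order.TTheory GRing.Theory Num.Theory.

Local Open Scope ring_scope.
Local Open Scope complex_scope.

Section ComplexPower.
Variable R : realType.
Implicit Types z a : R[i].

Definition cexp z : R[i] :=
  (expR (complex.Re z))%:C * (cos (complex.Im z) +i* sin (complex.Im z)).

(* Principal argument, with values in ]-pi, pi] for z != 0. *)
Definition carg z : R :=
  let t := acos (complex.Re z / Normc.normc z) in
  if 0 <= complex.Im z then t else - t.

Definition clog z : R[i] := ln (Normc.normc z) +i* carg z.

(* Principal branch; at z = 0 the convention is that of powR. *)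
Definition cpow z a : R[i] :=
  if z == 0 then (a == 0)%:R else cexp (a * clog z).

End ComplexPower.

Section Ball.
Variable R : realType.
Implicit Types z w : 'rV[R[i]]_2.

(* dotmx is linear in its first argument and conjugate-linear in its second:
   dotmx z w = \sum_i z 0 i * (w 0 i)^* *)
Definition enorm z : R[i] := sqrtC (dotmx z z).

Definition unit_ball : set 'rV[R[i]]_2 := [set z | enorm z < 1]%classic.

(* Real quantities, such as norms and moduli, are viewed in R[i], where x <= y
   means that y - x is a nonnegative real. *)
Definition Bfun z w : R[i] := 1 - dotmx z w.
Definition Dfun z : R[i] := Bfun z z.
Definition Mfun z w : R[i] := `|Bfun z w|.
Definition Lfun z : R[i] := Dfun z.
Definition RLfun z w : R[i] := Mfun z w / Lfun z.
Definition Ufun z w : R[i] := Bfun z w / Mfun z w.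

End Ball.

(* Main.v *)
Require Import Defs.
From mathcomp Require Import all_boot all_order all_algebra.
From mathcomp Require Import spectral.
From mathcomp Require Import complex.
From mathcomp Require Import boolp classical_sets reals sequences exp trigo.

Import Order.TTheory GRing.Theory Num.Theory.

Set Implicit Arguments.
Unset Strict Implicit.
Unset Printing Implicit Defensive.

Local Open Scope ring_scope.
Local Open Scope complex_scope.

(** The inequality of Cauchy and Schwarz gives |<z,w>| < 1 on the ball, so B and
D do not vanish and D > 0.  The principal argument is unchanged by scaling by a
positive real, hence the principal power satisfies (x c)^a = x^a c^a whenever
x <> 0 and c > 0.  The factorizations B = U M and M = R_L D have positive
second factors, so B^a = U^a R_L^a D^a, and D^a is invertible. *)

Lemma cexpD (R : realType) (x y : R[i]) : cexp (x + y) = cexp x * cexp y.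
Proof.
case: x y => [a b] [c d]; rewrite /cexp /= expRD rmorphM /= mulrACA cosD sinD.
congr (_ * _); apply/eqP; rewrite eq_complex /= eqxx /=.
by rewrite addrC [cos b * _]mulrC.
Qed.

(** The product with [cexp (- x)] is [cexp 0], which is 1. *)
Lemma cexp_neq0 (R : realType) (x : R[i]) : cexp x != 0.
Proof.
apply/eqP => x0; have := cexpD x (- x).
rewrite subrr x0 mul0r /cexp /= expR0 cos0 sin0 mul1r => /eqP.
by rewrite eq_complex /= oner_eq0.
Qed.

Lemma normc_real_pos (R : realType) (c : R) : 0 < c -> Normc.normc c%:C = c.
Proof. by move=> c0; rewrite /= expr0n addr0 sqrtr_sqr gtr0_norm. Qed.

Lemma normc_gt0 (R : realType) (x : R[i]) : x != 0 -> 0 < Normc.normc x.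
Proof.
move=> x0; rewrite lt_def; apply/andP; split.
  by apply: contra x0 => /eqP/Normc.eq0_normc ->.
by case: x {x0} => a b; exact: sqrtr_ge0.
Qed.

Lemma carg_real_pos (R : realType) (c : R) : 0 < c -> carg c%:C = 0.
Proof.
move=> c0; rewrite /carg normc_real_pos //= lexx divff ?acos1 //.
exact: lt0r_neq0.
Qed.

(** [carg] depends only on the quotient of the real part by the modulus and on the sign of the
    imaginary part; both survive the scaling. *)
Lemma cargM_pos (R : realType) (x : R[i]) (c : R) :
  0 < c -> carg (x * c%:C) = carg x.
Proof.
move=> c0; rewrite /carg Normc.normcM normc_real_pos //.
have -> : complex.Im (x * c%:C) = complex.Im x * c.
  by case: x => a b /=; rewrite mulr0 add0r.
have -> : complex.Re (x * c%:C) = complex.Re x * c.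
  by case: x => a b /=; rewrite mulr0 subr0.
by rewrite pmulr_lge0 // -mulf_div divff ?mulr1 // lt0r_neq0.
Qed.

(** No multiple of 2 pi i appears, since the argument of [c%:C] is 0; the moduli multiply under
    [ln]. *)
Lemma clogM_pos (R : realType) (x : R[i]) (c : R) :
  x != 0 -> 0 < c -> clog (x * c%:C) = clog x + clog c%:C.
Proof.
move=> x0 c0; rewrite /clog cargM_pos // Normc.normcM carg_real_pos //.
rewrite normc_real_pos // lnM ?posrE ?normc_gt0 //.
by apply/eqP; rewrite eq_complex /= addr0 !eqxx.
Qed.

Lemma cpow_neq0 (R : realType) (x a : R[i]) : x != 0 -> cpow x a != 0.
Proof. by move=> x0; rewrite /cpow (negbTE x0) cexp_neq0. Qed.

Lemma cpowM_pos (R : realType) (x c a : R[i]) :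
  x != 0 -> 0 < c -> cpow (x * c) a = cpow x a * cpow c a.
Proof.
move=> x0 c0; have cn0 := lt0r_neq0 c0.
rewrite /cpow mulf_eq0 (negbTE x0) (negbTE cn0) /=.
(* Positivity in [R[i]] includes being real. *)
have /complex_realP[r cE] : c \is Num.real by exact: gtr0_real.
move: c0; rewrite cE ltcR => r0.
by rewrite clogM_pos // mulrDr cexpD.
Qed.

(** Cauchy-Schwarz bounds the modulus by a product of two norms in [0, 1). *)
Lemma unit_ball_dotmx_lt1 (R : realType) (z w : 'rV[R[i]]_2) :
  unit_ball z -> unit_ball w -> `|dotmx z w| < 1.
Proof.
rewrite /unit_ball /enorm /= => hz hw.
apply: (le_lt_trans (CauchySchwarz_sqrt (@dotmx _ 2) z w)).
by rewrite mulr_ilt1 // sqrtC_ge0 dnorm_ge0.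
Qed.

Lemma Bfun_neq0 (R : realType) (z w : 'rV[R[i]]_2) :
  unit_ball z -> unit_ball w -> Bfun z w != 0.
Proof.
move=> hz hw; rewrite /Bfun subr_eq0; apply/eqP => e.
by have := unit_ball_dotmx_lt1 hz hw; rewrite -e normr1 ltxx.
Qed.

(** [dotmx z z] is nonnegative, so it equals its modulus, which is below 1. *)
Lemma Dfun_gt0 (R : realType) (z : 'rV[R[i]]_2) : unit_ball z -> 0 < Dfun z.
Proof.
move=> hz; rewrite /Dfun /Bfun subr_gt0.
by have := unit_ball_dotmx_lt1 hz hz; rewrite ger0_norm ?dnorm_ge0.
Qed.

Theorem proposition18p1 (R : realType) (gamma : R[i]) (hgamma : gamma != 0)
    (z w : 'rV[R[i]]_2) (hz : unit_ball z) (hw : unit_ball w) :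
  [/\ Bfun z w != 0,
      Dfun z != 0,
      Mfun z w != 0,
      Lfun z != 0 &
      cpow (Bfun z w) (- gamma) / cpow (Dfun z) (- gamma)
        = cpow (Ufun z w) (- gamma) * cpow (RLfun z w) (- gamma)].
Proof.
have B0 := Bfun_neq0 hz hw.
have Dp := Dfun_gt0 hz; have D0 := lt0r_neq0 Dp.
(* [normr_gt0] is a boolean equation, chained here with [B0] read as an equation to [true]. *)
have Mp : 0 < Mfun z w := etrans (normr_gt0 _) B0.
have M0 := lt0r_neq0 Mp.
split=> //.
(* [cpowM_pos] asks its first factor to be nonzero: here [RLfun z w], then [Ufun z w]. *)
have RL0 : RLfun z w != 0 := mulf_neq0 M0 (invr_neq0 D0).
have U0 : Ufun z w != 0 := mulf_neq0 B0 (invr_neq0 M0).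
have BE : Bfun z w = Ufun z w * Mfun z w by rewrite divfK.
have ME : Mfun z w = RLfun z w * Dfun z by rewrite divfK.
rewrite {1}BE cpowM_pos // {1}ME cpowM_pos // mulrA mulfK //.
exact: cpow_neq0.
Qed.
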